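(* Let $m\ge 2$, $n\ge 1$ be integers, $\mathcal{A}\in T_{m,n}$ and $q\in\mathbb{R}^n$. Consider the mixed integer program, in the variables $\alpha\in\mathbb{R}$, $y\in\mathbb{R}^n$, $z\in\{0,1\}^n$, $$ \begin{aligned} \max_{\alpha,y,z}\quad & \alpha^{m-1}\\ \text{s.t.}\quad & 0\le \mathcal{A}y^{m-1}+\alpha^{m-1}q\le e-z,\\ & 0\le y\le z,\quad \alpha\ge 0,\\ & z\in\{0,1\}^n. \end{aligned} $$ Let $(\alpha^*,y^*,z^* )$ be any optimal solution of this program. If $\alpha^*>0$, then $x=y^*/\alpha^*$ is a solution of TCP$(\mathcal{A},q)$. If $\alpha^*=0$, then TCP$(\mathcal{A},q)$ has no solution.
   Context: $[n]=\{1,\ldots,n\}$ and $e=(1,\ldots,1)^\top\in\mathbb{R}^n$. $T_{m,n}$ is the set of all real $m$th-order $n$-dimensional tensors, i.e. arrays $\mathcal{A}=(a_{i_1\ldots i_m})$ of real numbers with $i_1,\ldots,i_m\in[n]$. For $x\in\mathbb{R}^n$, $\mathcal{A}x^{m-1}\in\mathbb{R}^n$ is the vector with components $(\mathcal{A}x^{m-1})_i=\sum_{i_2,\ldots,i_m=1}^{n}a_{ii_2\ldots i_m}x_{i_2}\cdots x_{i_m}$. Vector inequalities are componentwise. The tensor complementarity problem TCP$(\mathcal{A},q)$ is: find $x\in\mathbb{R}^n$ with $x\ge 0$, $\mathcal{A}x^{m-1}+q\ge 0$ and $x^\top(\mathcal{A}x^{m-1}+q)=0$; such an $x$ is called a solution.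 *)

(* Defs.v *)
From HB Require Import structures.
From mathcomp Require Import all_boot all_order all_algebra.
From mathcomp Require Import reals.

Set Implicit Arguments.
Unset Strict Implicit.
Unset Printing Implicit Defensive.

Import Order.TTheory GRing.Theory Num.Theory.
Local Open Scope ring_scope.

(* [n] = {1, ..., n} is encoded as 'I_n = {0, ..., n-1}. *)
Definition tensor (R : realType) (m n : nat) : Type :=
  {ffun m.-tuple 'I_n -> R}.

(* The multi-index (i, i_2, ..., i_m), for m >= 1.  It is built by lookup in
   the sequence i :: t, of length m, so that m need not be syntactically a
   successor; the default value of nth is never reached. *)
Definition multi_index (m n : nat) (i : 'I_n) (t : m.-1.-tuple 'I_n) :
    m.-tuple 'I_n :=
  [tuple nth i (i :: t) k | k < m].

(* The vector A x^{m-1}; t ranges over all (i_2, ..., i_m). *)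
Definition tensor_apply (R : realType) (m n : nat)
    (A : tensor R m n) (x : 'cV[R]_n) : 'cV[R]_n :=
  \col_(i < n) \sum_(t : m.-1.-tuple 'I_n)
    A (multi_index i t) * \prod_(k < m.-1) x (tnth t k) 0.

Definition vec_le (R : realType) (n : nat) (u v : 'cV[R]_n) : Prop :=
  forall i : 'I_n, u i 0 <= v i 0.

Definition TCP_solution (R : realType) (m n : nat)
    (A : tensor R m n) (q x : 'cV[R]_n) : Prop :=
  [/\ vec_le 0 x,
      vec_le 0 (tensor_apply A x + q)
    & (x^T *m (tensor_apply A x + q)) 0 0 = 0].

Definition binary_vec (R : realType) (n : nat) (z : 'cV[R]_n) : Prop :=
  forall i : 'I_n, z i 0 = 0 \/ z i 0 = 1.

Definition MIP_feasible (R : realType) (m n : nat)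
    (A : tensor R m n) (q : 'cV[R]_n)
    (alpha : R) (y z : 'cV[R]_n) : Prop :=
  [/\ vec_le 0 (tensor_apply A y + alpha ^+ m.-1 *: q) /\
      vec_le (tensor_apply A y + alpha ^+ m.-1 *: q) (const_mx 1 - z),
      vec_le 0 y /\ vec_le y z,
      0 <= alpha
    & binary_vec z].

Definition MIP_objective (R : realType) (m : nat) (alpha : R) : R :=
  alpha ^+ m.-1.

Definition MIP_optimal (R : realType) (m n : nat)
    (A : tensor R m n) (q : 'cV[R]_n)
    (alpha : R) (y z : 'cV[R]_n) : Prop :=
  MIP_feasible A q alpha y z /\
  forall (alpha' : R) (y' z' : 'cV[R]_n),
    MIP_feasible A q alpha' y' z' ->
    MIP_objective m alpha' <= MIP_objective m alpha.

(* Main.v *)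
Require Import Defs.
From HB Require Import structures.
From mathcomp Require Import all_boot all_order all_algebra.
From mathcomp Require Import reals.

Set Implicit Arguments.
Unset Strict Implicit.
Unset Printing Implicit Defensive.

Import Order.TTheory GRing.Theory Num.Theory.
Local Open Scope ring_scope.

(** Since [x |-> A x^(m-1)] is homogeneous of degree [m-1], scaling [x] by [c]
    scales the residual [A x^(m-1) + q] by [c^(m-1)], provided that [q] is
    scaled too ([tensor_apply_homogenize]).  Hence, up to scaling, the feasible
    points with [alpha > 0] are the solutions of the complementarity problem.

    From a feasible point to a solution ([feasible_TCP_solution]): the binary
    variable [z i] forces [y i] to vanish when it is [0] and the [i]-th
    residual to vanish when it is [1], so [y] and its residual are
    complementary, and dividing by [alpha] preserves this.

    From a solution to a feasible point ([TCP_solution_feasible]): shrink [x]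
    by a small [alpha > 0] until [x] and its residual fit below [1], and let
    [z] be the indicator of the support of [x].  If an optimal [alpha] were
    [0], this point would have a strictly larger objective, as [m-1 > 0]. *)

Section Scaling.
Variables (R : realType) (m n : nat) (A : tensor R m n).

Lemma tensor_applyZ (c : R) (x : 'cV[R]_n) :
  tensor_apply A (c *: x) = c ^+ m.-1 *: tensor_apply A x.
Proof.
apply/colP => i; rewrite !mxE mulr_sumr; apply: eq_bigr => t _.
under eq_bigr do rewrite mxE.
by rewrite big_split /= prodr_const card_ord mulrCA.
Qed.

Lemma tensor_apply_homogenize (c : R) (q x : 'cV[R]_n) :
  tensor_apply A (c *: x) + c ^+ m.-1 *: q =
  c ^+ m.-1 *: (tensor_apply A x + q).
Proof. by rewrite tensor_applyZ scalerDr. Qed.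

End Scaling.

Lemma vec_le0Z (R : realType) (n : nat) (c : R) (u : 'cV[R]_n) :
  0 <= c -> vec_le 0 u -> vec_le 0 (c *: u).
Proof. by move=> c0 u0 i; move: (u0 i); rewrite !mxE => ui; apply: mulr_ge0. Qed.

(** A sum of nonnegative terms vanishes only if each of them does. *)
Lemma dot_eq0P (R : realType) (n : nat) (u v : 'cV[R]_n) :
  vec_le 0 u -> vec_le 0 v ->
  (u^T *m v) 0 0 = 0 <-> forall i, u i 0 * v i 0 = 0.
Proof.
move=> u0 v0; rewrite mxE; split=> [dot0 i | uv0]; last first.
  by apply: big1 => i _; rewrite mxE.
have term_ge0 j : true -> 0 <= u^T 0 j * v j 0.
  by move=> _; move: (u0 j) (v0 j); rewrite !mxE; apply: mulr_ge0.
by have := psumr_eq0P term_ge0 dot0 (i := i) isT; rewrite mxE.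
Qed.

(** Shrinking by the inverse of one plus the sum of the entries works; the added
    [1] covers [u = 0] and gives [c <= 1], needed to compare powers of [c]. *)
Lemma scale_entries_le1 (R : realType) (n : nat) (u : 'cV[R]_n) :
  vec_le 0 u ->
  exists c : R, [/\ 0 < c, c <= 1 & forall i, c * u i 0 <= 1].
Proof.
move=> u0; have ui0 i : 0 <= u i 0 by move: (u0 i); rewrite mxE.
pose s := 1 + \sum_j u j 0.
have s1 : 1 <= s by rewrite lerDl; apply: sumr_ge0.
have s0 : 0 < s := lt_le_trans ltr01 s1.
exists s^-1; split=> [||i]; rewrite ?invr_gt0 ?invf_le1 //.
rewrite mulrC ler_pdivrMr // mul1r /s (bigD1 i) //= addrCA lerDl.
by apply: addr_ge0 => //; apply: sumr_ge0.
Qed.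

Lemma feasible_TCP_solution (R : realType) (m n : nat) (A : tensor R m n)
    (q y z : 'cV[R]_n) (alpha : R) :
  0 < alpha -> MIP_feasible A q alpha y z -> TCP_solution A q (alpha^-1 *: y).
Proof.
move=> a0 [[w0 wz] [y0 yz] _ zbin].
have an0 : alpha != 0 by rewrite gt_eqF.
have residual : tensor_apply A (alpha^-1 *: y) + q =
    alpha^-1 ^+ m.-1 *: (tensor_apply A y + alpha ^+ m.-1 *: q).
  rewrite -tensor_apply_homogenize scalerA -exprMn.
  by rewrite mulVf // expr1n scale1r.
have ai0 : 0 <= alpha^-1 by rewrite invr_ge0 ltW.
have x0 := vec_le0Z ai0 y0.
have r0 : vec_le 0 (tensor_apply A (alpha^-1 *: y) + q).
  by rewrite residual; apply: vec_le0Z => //; apply: exprn_ge0.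
split=> //; apply/dot_eq0P => // i; rewrite residual.
move: (tensor_apply A y + _) w0 wz => w w0 wz.
move: (w0 i) (wz i) (y0 i) (yz i); rewrite !mxE.
case: (zbin i) => -> => wi0 wi1 yi0 yi1.
  have -> : y i 0 = 0 by apply: le_anti; rewrite yi0 yi1.
  by rewrite mulr0 mul0r.
have -> : w i 0 = 0 by apply: le_anti; rewrite wi0 andbT -(subrr 1).
by rewrite !mulr0.
Qed.

Lemma TCP_solution_feasible (R : realType) (m n : nat) (A : tensor R m n)
    (q x : 'cV[R]_n) :
  (2 <= m)%N -> TCP_solution A q x ->
  exists alpha y z, 0 < alpha /\ MIP_feasible A q alpha y z.
Proof.
move=> hm [x0 + +]; move defw: (tensor_apply A x + q) => w w0.
move=> /(dot_eq0P x0 w0) xw0.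
have xi0 i : 0 <= x i 0 by move: (x0 i); rewrite mxE.
have wi0 i : 0 <= w i 0 by move: (w0 i); rewrite mxE.
have xw_ge0 : vec_le 0 (x + w) by move=> i; rewrite !mxE addr_ge0.
have [a [a0 a1 fits]] := scale_entries_le1 xw_ge0.
have ax1 i : a * x i 0 <= 1.
  by apply: le_trans (fits i); rewrite mxE ler_wpM2l ?lerDl // ltW.
have aw1 i : a ^+ m.-1 * w i 0 <= 1.
  (* The residual is multiplied by a^(m-1) instead of a, and a^(m-1) <= a as a <= 1. *)
  apply: le_trans (fits i); rewrite mxE mulrDr; apply: ler_wpDl.
    by rewrite mulr_ge0 // ltW.
  by apply: ler_wpM2r => //; rewrite ler_iXnr // ?ltW // -subn1 subn_gt0.
exists a, (a *: x), (\col_i (x i 0 != 0)%:R); split=> //.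
rewrite /MIP_feasible tensor_apply_homogenize defw.
split; [split|split|exact: ltW|] => [|i||i|i].
- by apply: vec_le0Z => //; rewrite exprn_ge0 // ltW.
- rewrite !mxE; case: eqVneq => [_|xi_neq0]; first by rewrite subr0.
  have /eqP := xw0 i; rewrite mulf_eq0 (negPf xi_neq0) /= => /eqP ->.
  by rewrite mulr0 subrr.
- by apply: vec_le0Z => //; apply: ltW.
- by rewrite !mxE; case: eqVneq => [->|_] //; rewrite mulr0.
- by rewrite mxE; case: (x i 0 != 0); [right | left].
Qed.

Theorem theorem2 (R : realType) (m n : nat) (hm : (2 <= m)%N) (hn : (1 <= n)%N)
    (A : tensor R m n) (q : 'cV[R]_n)
    (alpha : R) (y z : 'cV[R]_n)
    (hopt : MIP_optimal A q alpha y z) :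
  (0 < alpha -> TCP_solution A q (alpha^-1 *: y)) /\
  (alpha = 0 -> ~ exists x : 'cV[R]_n, TCP_solution A q x).
Proof.
have [feas opt] := hopt; split=> [a0 | a0 [x xsol]].
  exact: feasible_TCP_solution a0 feas.
have [b [y' [z' [b0 /opt]]]] := TCP_solution_feasible hm xsol.
have m1 : (0 < m.-1)%N by rewrite -subn1 subn_gt0.
by rewrite /MIP_objective a0 expr0n (gtn_eqF m1) leNgt exprn_gt0.
Qed.
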